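(* Let $\mathcal A=\bigcup_{i=1}^s L_i\subset\mathbb P^n$ ($s\ge 2$, $n\ge 2$) be an arbitrary hyperplane arrangement, where the hyperplane $L_i$ is defined by the linear form $\ell_i$. Then the top dimensional part of the scheme defined by $\mathrm{Jac}(\ell_1\cdots\ell_s)$ is a union of complete intersections. Each of these complete intersections is supported at some linear space $\Lambda=L_i\cap L_j$ ($i\neq j$) and is equal to the scheme defined by $\mathrm{Jac}(f)$, where $f$ is the product of those linear forms among $\ell_1,\dots,\ell_s$ that lie in $I_\Lambda$.
   Context: $K$ is an algebraically closed field of characteristic zero and $S=K[x_0,\dots,x_n]$. The hyperplanes $L_1,\dots,L_s$ are distinct. For a form $h\in S$, $\mathrm{Jac}(h)=\left(\frac{\partial h}{\partial x_0},\dots,\frac{\partial h}{\partial x_n}\right)$. The top dimensional part of the scheme defined by $J=\mathrm{Jac}(\ell_1\cdots\ell_s)$ is the scheme defined by $J^{top}$, the intersection of the primary components of height two in a primary decomposition of $J$. $I_\Lambda$ is the homogeneous ideal of the codimension two linear space $\Lambda$. *)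

(* Defs.v *)
From mathcomp Require Import all_boot all_order all_algebra.
From mathcomp Require Import boolp mpoly.

Set Implicit Arguments.
Unset Strict Implicit.
Unset Printing Implicit Defensive.

Import GRing.Theory.
Local Open Scope ring_scope.

(* Ideals are collective predicates.  [idealr_closed] (from ring_quotient)
   describes PROPER ideals: it includes 1 \notin I. *)

Section Ideals.
Variable R : comNzRingType.
Implicit Types (I J P Q : {pred R}).

Definition ideal_gen (gs : seq R) : {pred R} :=
  [pred f | `[< exists c : 'I_(size gs) -> R,
                  f = \sum_(i < size gs) c i * gs`_i >]].

Definition bigcap_ideal (m : nat) (Q : 'I_m -> {pred R}) : {pred R} :=
  [pred f | [forall k, f \in Q k]].

Definition is_prime_ideal P : Prop :=
  idealr_closed P /\ prime_idealr_closed P.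

Definition is_primary_ideal Q : Prop :=
  idealr_closed Q /\
  forall u v : R, u * v \in Q -> u \in Q \/ exists k : nat, v ^+ k \in Q.

(* There is a strict chain C 0 < C 1 < ... < C h = P of prime ideals. *)
Definition prime_height_ge P (h : nat) : Prop :=
  exists C : nat -> {pred R},
    [/\ forall i, (i <= h)%N -> is_prime_ideal (C i),
        forall i, (i < h)%N ->
          {subset C i <= C i.+1} /\ ~ {subset C i.+1 <= C i}
      & C h =i P].

Definition prime_height P (h : nat) : Prop :=
  prime_height_ge P h /\ ~ prime_height_ge P h.+1.

(* The height of I is the minimum of the heights of the primes containing I. *)
Definition ideal_height I (h : nat) : Prop :=
  (exists P, [/\ is_prime_ideal P, {subset I <= P} & prime_height P h]) /\
  (forall P, is_prime_ideal P -> {subset I <= P} -> prime_height_ge P h).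

(* No irredundancy is required. *)
Definition primary_decomposition J (m : nat) (Q : 'I_m -> {pred R}) : Prop :=
  (forall k, is_primary_ideal (Q k)) /\ J =i bigcap_ideal Q.

(* T is the intersection of the components of height h in some primary
   decomposition of J. *)
Definition is_height_part (h : nat) J (T : {pred R}) : Prop :=
  exists (m : nat) (Q : 'I_m -> {pred R}),
    primary_decomposition J Q /\
    forall f, f \in T <-> (forall k, ideal_height (Q k) h -> f \in Q k).

Definition regular_sequence (gs : seq R) : Prop :=
  1 \notin ideal_gen gs /\
  forall i, (i < size gs)%N -> forall a : R,
    gs`_i * a \in ideal_gen (take i gs) -> a \in ideal_gen (take i gs).

End Ideals.

Section ProjectiveSpace.
Variables (K : fieldType) (n : nat).
Local Notation S := {mpoly K[n.+1]}.
Implicit Types (I J : {pred S}) (h f : S).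

Definition jacobian_ideal h : {pred S} :=
  ideal_gen [seq h^`M(i) | i <- enum 'I_n.+1].

(* Saturation with respect to the irrelevant ideal (x_0, ..., x_n); its k-th
   power is generated by the forms of degree k. *)
Definition saturation I : {pred S} :=
  [pred f | `[< exists k : nat,
                  forall g : S, g \is k.-homog -> g * f \in I >]].

(* I and J define the same closed subscheme of P^n. *)
Definition same_scheme I J : Prop := saturation I =i saturation J.

(* I is the saturated homogeneous ideal of a complete intersection in P^n. *)
Definition complete_intersection I : Prop :=
  saturation I =i I /\
  exists gs : seq S,
    [/\ forall g, g \in gs -> exists d : nat, g \is d.-homog,
        regular_sequence gs
      & I =i ideal_gen gs].

(* Subsets of P^n are given by the nonzero vectors representing their points. *)
Definition hyperplane f : {pred 'rV[K]_n.+1} :=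
  [pred v : 'rV[K]_n.+1 | (v != 0) && (f.@[v 0] == 0)].

Definition zero_locus I : {pred 'rV[K]_n.+1} :=
  [pred v : 'rV[K]_n.+1 | (v != 0) && `[< forall f, f \in I -> f.@[v 0] = 0 >]].

Definition vanishing_ideal (A : {pred 'rV[K]_n.+1}) : {pred S} :=
  [pred f | `[< forall v, v \in A -> f.@[v 0] = 0 >]].

End ProjectiveSpace.

(* Main.v *)
Require Import Defs.
From mathcomp Require Import all_boot all_order all_algebra.
From mathcomp Require Import boolp mpoly.
From mathcomp Require Import polyXY ring.

(* For a plane Lambda = L_i \cap L_j let f be the product of the forms in
   I_Lambda = (x, y), x = l_i, y = l_j, and u the product of the others, so that
   h = l_1 ... l_s = f u.  Euler's formula gives Jac(h) <= Jac(f), and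
   u (dh) - h (du) = u^2 (df) gives u^2 Jac(f) <= Jac(h).  Moreover Jac(f) is
   generated by two forms A, A', and is I_Lambda-primary: write m_t = f / l_t; then
   m_t^2 lies in Jac(f), which forces every element of I_Lambda to be nilpotent
   modulo Jac(f), while, in coordinates where A is monic in y, division by A shows
   that nonzero polynomials in the remaining variables are regular modulo Jac(f).
   A prime containing Jac(h) contains some I_Lambda, and I_Lambda has height exactly
   2, so the components of height two of Jac(h) are those contained in some
   I_Lambda; each I_Lambda isolates Jac(f), and their intersection is that of all
   the Jac(f). *)

Set Implicit Arguments.
Unset Strict Implicit.
Unset Printing Implicit Defensive.

Import GRing.Theory.
Local Open Scope ring_scope.

(** * Ideals *)

Section IdealClosed.
Variable R : comNzRingType.
Implicit Types (I : R -> Prop) (gs : seq R) (Q : {pred R}).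

(** Unlike [idealr_closed], this admits the unit ideal, so every colon ideal qualifies. *)
Definition ideal_closed I : Prop :=
  [/\ I 0, forall u v, I u -> I v -> I (u + v) & forall c u, I u -> I (c * u)].

Lemma ideal_closed_sum I (T : Type) (r : seq T) (P : pred T) (F : T -> R) :
  ideal_closed I -> (forall t, P t -> I (F t)) -> I (\sum_(t <- r | P t) F t).
Proof. by case=> I0 ID _ IF; elim/big_ind: _. Qed.

Lemma ideal_closedMr I u c : ideal_closed I -> I u -> I (u * c).
Proof. by case=> _ _ IM Iu; rewrite mulrC; apply: IM. Qed.

Lemma ideal_closedB I u v : ideal_closed I -> I u -> I v -> I (u - v).
Proof. by case=> _ ID IM Iu Iv; apply: ID => //; rewrite -mulN1r; apply: IM. Qed.

Lemma ideal_closed_colon I c :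
  ideal_closed I -> ideal_closed (fun u => I (u * c)).
Proof.
case=> I0 ID IM; split; first by rewrite mul0r.
  by move=> u v Iu Iv; rewrite mulrDl; apply: ID.
by move=> d u Iu; rewrite -mulrA; apply: IM.
Qed.

Lemma ideal_closed_proper Q : idealr_closed Q -> ideal_closed (fun f => f \in Q).
Proof.
case=> Q0 _ Qlin; split=> // [u v Qu Qv|c u Qu].
  by rewrite -[u]mul1r; apply: Qlin.
by rewrite -[c * u]addr0; apply: Qlin.
Qed.

Lemma ideal_gen_closed gs : ideal_closed (fun f => f \in ideal_gen gs).
Proof.
split=> [|u v /asboolP[c ->] /asboolP[d ->]|d u /asboolP[c ->]]; apply/asboolP.
- by exists (fun=> 0); rewrite big1 // => i _; rewrite mul0r.
- by exists (fun i => c i + d i); rewrite -big_split /=; under eq_bigr do rewrite -mulrDl.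
- by exists (fun i => d * c i); rewrite mulr_sumr; under eq_bigr do rewrite mulrA.
Qed.

Lemma ideal_gen_sum gs (T : Type) (r : seq T) (P : pred T) (F : T -> R) :
  (forall t, P t -> F t \in ideal_gen gs) -> \sum_(t <- r | P t) F t \in ideal_gen gs.
Proof. exact: ideal_closed_sum (ideal_gen_closed gs). Qed.

Lemma ideal_gen_mull gs c u : u \in ideal_gen gs -> c * u \in ideal_gen gs.
Proof. by case: (ideal_gen_closed gs) => _ _; apply. Qed.

Lemma ideal_gen_mulr gs c u : u \in ideal_gen gs -> u * c \in ideal_gen gs.
Proof. by rewrite mulrC; apply: ideal_gen_mull. Qed.

Lemma ideal_genD gs u v :
  u \in ideal_gen gs -> v \in ideal_gen gs -> u + v \in ideal_gen gs.
Proof. by case: (ideal_gen_closed gs) => _ + _; apply. Qed.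

Lemma ideal_genB gs u v :
  u \in ideal_gen gs -> v \in ideal_gen gs -> u - v \in ideal_gen gs.
Proof. exact: ideal_closedB (ideal_gen_closed gs). Qed.

Lemma mem_ideal_gen gs g : g \in gs -> g \in ideal_gen gs.
Proof.
move=> gin; have lt : (index g gs < size gs)%N by rewrite index_mem.
apply/asboolP; exists (fun i => (i == Ordinal lt)%:R).
rewrite (bigD1 (Ordinal lt)) //= eqxx mul1r nth_index //.
by rewrite big1 ?addr0 // => i /negPf ->; rewrite mul0r.
Qed.

Lemma ideal_gen_min gs I f :
  ideal_closed I -> (forall g, g \in gs -> I g) -> f \in ideal_gen gs -> I f.
Proof.
move=> Icl Igs /asboolP[c ->]; apply: ideal_closed_sum => // i _.
by case: Icl => _ _; apply; apply: Igs; apply: mem_nth.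
Qed.

Lemma ideal_gen1P (a f : R) : f \in ideal_gen [:: a] <-> exists c, f = c * a.
Proof.
split=> [/asboolP[c ->]|[c ->]].
  by exists (c ord0); rewrite big_ord1.
by apply/asboolP; exists (fun=> c); rewrite big_ord1.
Qed.

Lemma ideal_gen2P (a b f : R) :
  f \in ideal_gen [:: a; b] <-> exists c d, f = c * a + d * b.
Proof.
split=> [/asboolP[c ->]|[c [d ->]]].
  by exists (c ord0), (c (lift ord0 ord0)); rewrite big_ord_recl big_ord1.
by case: (ideal_gen_closed [:: a; b]) => _ ID IM; apply: ID; apply: IM;
  apply: mem_ideal_gen; rewrite !inE eqxx ?orbT.
Qed.

(** Modulo [I], u = -c; the difference u^k - (-c)^k is a multiple of u + c. *)
Lemma ideal_closed_exp_sub I c u k : ideal_closed I ->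
  I (u + c) -> I (c ^+ k) -> I (u ^+ k).
Proof.
move=> Icl Iuc Ick.
have -> : u ^+ k = (u ^+ k - (- c) ^+ k) + (-1) ^+ k * c ^+ k.
  by rewrite -exprMn mulN1r subrK.
case: (Icl) => _ ID IM; apply: ID; last exact: IM.
by rewrite subrXX opprK; apply: ideal_closedMr.
Qed.

End IdealClosed.

(** * Products of pairwise independent forms *)

Section BinaryProduct.
Variables (R : comNzRingType) (T : finType) (l : T -> R).
Implicit Types (D : {set T}) (I : R -> Prop).

Local Notation cofactor D t := (\prod_(r in D :\ t) l r).

(** Induction on [D]: if z = a l_t + b l_s, then z times the cofactor of t in [D :\ s] is a
    combination of the cofactors of s and t in [D]. So the colon ideal of [I] by z satisfies the
    hypotheses for [D :\ s]. *)
Lemma exp_in_cofactor_ideal (z : R) D I : D != set0 ->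
  {in D &, forall t s, t != s -> exists a b, z = a * l t + b * l s} ->
  ideal_closed I -> (forall t, t \in D -> I (cofactor D t)) ->
  exists k, I (z ^+ k).
Proof.
elim: {D}#|D| {-2}D (leqnn #|D|) I => [|k IHk] D leDk I.
  by rewrite -cards_eq0 -leqn0 leDk.
case/set0Pn=> s sD zD Icl Im.
have [D0|Dn0] := eqVneq (D :\ s) set0.
  (* The cofactor in a singleton is the empty product, so [I] contains 1. *)
  by exists 0; have := Im s sD; rewrite D0 big_set0 expr0.
have [||||t|e Ie] := IHk (D :\ s) _ (fun u => I (u * z)) => //.
- by rewrite -ltnS (leq_trans _ leDk) // [in ltnRHS](cardsD1 s) sD.
- by move=> t r /setD1P[_ tD] /setD1P[_ rD]; apply: zD.
- exact: ideal_closed_colon.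
- case/setD1P=> ts tD; have [a [b ->]] := zD t s tD sD ts.
  case: (Icl) => _ ID IM; rewrite mulrDr.
  apply: ID; rewrite mulrCA; apply: IM; rewrite mulrC.
    by rewrite -big_setD1 ?inE ?ts //; apply: Im.
  by rewrite setDDl setUC -setDDl -big_setD1 ?inE 1?eq_sym ?ts //; apply: Im.
- by exists e.+1; rewrite exprSr.
Qed.

Variables (a b : T -> R).

(** Products of two different cofactors are multiples of the full product. Hence a combination of
    the two sums with coefficient 1 at t, multiplied by the cofactor of t, shows that the square of
    this cofactor is in [I]. *)
Lemma exp_in_jacobian (z : R) D I : D != set0 ->
  {in D, forall t, exists c d, c * a t + d * b t = 1} ->
  {in D &, forall t s, t != s -> exists c d, z = c * l t + d * l s} ->
  ideal_closed I -> I (\prod_(t in D) l t) ->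
  I (\sum_(t in D) a t * cofactor D t) ->
  I (\sum_(t in D) b t * cofactor D t) ->
  exists k, I (z ^+ k).
Proof.
move=> Dn0 abD zD Icl If IA IB; case: (Icl) => I0 ID IM.
have Imm t s : t \in D -> s \in D -> t != s -> I (cofactor D t * cofactor D s).
  move=> tD sD ts; rewrite [X in _ * X](big_setD1 t) /= ?inE ?ts // mulrA.
  by apply: ideal_closedMr => //; rewrite mulrC -big_setD1.
have Isq t : t \in D -> I (cofactor D t * cofactor D t).
  move=> tD; have [c [d cd1]] := abD t tD; set m := cofactor D t.
  have -> : m * m = (\sum_(r in D) (c * a r + d * b r) * cofactor D r) * m
      - \sum_(r in D :\ t) (c * a r + d * b r) * (cofactor D r * m).
    rewrite (big_setD1 t) //= cd1 mul1r mulrDl mulr_suml.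
    by under [in X in _ + X - _]eq_bigr do rewrite -mulrA; rewrite addrK.
  apply: ideal_closedB => //.
    apply: ideal_closedMr => //; under eq_bigr do rewrite mulrDl -!mulrA.
    by rewrite big_split -!mulr_sumr; apply: ID; apply: IM.
  by apply: ideal_closed_sum => // r /setD1P[rt rD]; apply/IM/Imm.
(* Used first for the ideal of all u that multiply every cofactor into [I], then for the colon ideal
   of [I] by the power of z so found. *)
have [||k Ik] := exp_in_cofactor_ideal Dn0 zD
    (I := fun u => forall t, t \in D -> I (u * cofactor D t)).
- split=> [t|u v Iu Iv t tD|c u Iu t tD]; first by rewrite mul0r.
    by rewrite mulrDl; apply: ID; auto.
  by rewrite -mulrA; apply/IM/Iu.
- move=> s sD t tD; have [->|st] := eqVneq s t; [exact: Isq | exact: Imm].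
have [t tD|e Ie] := exp_in_cofactor_ideal Dn0 zD (ideal_closed_colon (z ^+ k) Icl).
  by rewrite mulrC; apply: Ik.
by exists (e + k)%N; rewrite exprD.
Qed.

End BinaryProduct.

(** * Division and prime chains in bivariate polynomials *)

Section MonicDivision.
Import Pdiv.RingMonic.
Variable C : idomainType.
Implicit Types (g a : {poly C}) (c : C).

(** Remainders by a monic [g] commute with scalars, so c times the remainder of a is 0. *)
Lemma monic_dvd_scale g a c q : g \is monic -> c != 0 ->
  c *: a = q * g -> exists r, a = r * g.
Proof.
move=> gm c0 caE; exists (Pdiv.Ring.rdivp a g).
suff r0 : Pdiv.CommonRing.rmodp a g = 0 by rewrite {1}(rdivp_eq gm a) r0 addr0.
have := congr1 (fun p => Pdiv.CommonRing.rmodp p g) caE.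
rewrite /= rmodpZ // rmodp_mull // => /eqP.
by rewrite scale_poly_eq0 (negPf c0) => /eqP.
Qed.
End MonicDivision.

Section Unmixed.
Import Pdiv.RingMonic.
Variable B : idomainType.
Local Notation T := {poly {poly B}}.

(** The scalars are polynomials in the inner variable x. In each coefficient, truncation below x^k
    kills the right side and commutes with the nonzero constant [b]. *)
Lemma dvd_Xn_scale (b : B) (r c : T) k : b != 0 ->
  b%:P *: r = 'X^k *: c -> exists r', r = 'X^k *: r'.
Proof.
move=> b0 brE; exists (\poly_(i < size r) drop_poly k r`_i).
apply/polyP=> i; rewrite coefZ coef_poly.
case: ltnP => [lt|le]; last by rewrite mulr0 nth_default.
rewrite mulrC -[LHS](poly_take_drop k) -[RHS]add0r; congr (_ + _).
have /(congr1 (take_poly k)) := congr1 (fun p : T => p`_i) brE.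
rewrite !coefZ ['X^k * _]mulrC take_polyMXn_0 mul_polyC take_polyZ => /eqP.
by rewrite scale_poly_eq0 (negPf b0) => /eqP.
Qed.

(* Modulo the monic [g], multiplication by [b] and by ['X^k] act
   coefficientwise on remainders, where [b] and ['X^k] are coprime. *)
Lemma unmixed_monic (g g' a u v c c' : T) (b : B) k : g \is monic -> b != 0 ->
  ('X^k)%:P = u * g' + v * g -> b%:P%:P * a = c' * g' + c * g ->
  exists d d', a = d' * g' + d * g.
Proof.
move=> gm b0 XE baE; pose md p := Pdiv.CommonRing.rmodp p g.
pose q := Pdiv.CommonRing.rdivp c' g.
have c'E : c' = q * g + md c' by apply: rdivp_eq.
(* Multiply b a = c' g' by u, both modulo [g], where u g' = x^k. *)
have E1 : b%:P *: md (a * u) = 'X^k *: md c'.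
  rewrite /md -!rmodpZ // -!mul_polyC XE.
  have -> : b%:P%:P * (a * u) =
      (u * g' + v * g) * c' + (c * u - v * c') * g by rewrite mulrA baE; ring.
  by rewrite rmodpD // rmodp_mull // addr0.
have [r rE] := dvd_Xn_scale b0 E1.
have c'r : md c' = b%:P *: r.
  have X0 : ('X^k)%:P != 0 :> T by rewrite polyC_eq0 monic_neq0 ?monicXn.
  by apply: (mulfI X0); rewrite !mul_polyC -E1 rE !scalerA mulrC.
have [||d dE] := @monic_dvd_scale _ g (a - r * g') b%:P (c + q * g') gm.
- by rewrite polyC_eq0.
- by rewrite -mul_polyC mulrBr baE c'E c'r -mul_polyC; ring.
by exists d, r; rewrite -dE addrC subrK.
Qed.

End Unmixed.

(** * Chains of prime ideals *)

Definition prime_closed (R : comNzRingType) (P : R -> Prop) : Prop :=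
  [/\ ideal_closed P, ~ P 1 & forall u v, P (u * v) -> P u \/ P v].

Section PolyChain.
Variable C : idomainType.
Implicit Types (P Q : {poly C} -> Prop).

(* A polynomial of least degree in [Q] divides every element of [Q] up to a
   nonzero constant, so repeated division brings the elements of [P] down. *)
Lemma prime_chain_const P Q : prime_closed P -> prime_closed Q ->
  (forall c : C, Q c%:P -> c = 0) -> (forall f, P f -> Q f) ->
  (exists2 f, P f & f != 0) -> forall f, Q f -> P f.
Proof.
move=> [Pcl _ Ppr] [Qcl _ _] QC PQ [f0 Pf0 f0n0].
have [g [Qg gn0 gmin]] : exists g, [/\ Q g, g != 0 &
    forall h, Q h -> h != 0 -> (size g <= size h)%N].
  have exn : exists k, `[< exists2 g, Q g /\ g != 0 & size g = k >].
    by exists (size f0); apply/asboolP; exists f0; split; auto.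
  case: (ex_minnP exn) => k /asboolP[g [Qg g0] <-] kmin.
  by exists g; split=> // h Qh h0; apply: kmin; apply/asboolP; exists h.
have dvdg h : Q h -> lead_coef g ^+ Pdiv.Idomain.scalp h g *: h
    = (h %/ g) * g.
  move=> Qh; have E := Pdiv.Idomain.divp_eq h g; rewrite E.
  suff -> : h %% g = 0 by rewrite addr0.
  apply/eqP/negPn/negP => r0; have := ltn_modp h g; rewrite gn0 ltnNge gmin //.
  have -> : h %% g = lead_coef g ^+ Pdiv.Idomain.scalp h g *: h - (h %/ g) * g.
    by rewrite E addrC addKr.
  case: (Qcl) => _ _ IM.
  by apply: ideal_closedB => //; rewrite -?mul_polyC; apply: IM.
have lcn0 k : lead_coef g ^+ k != 0 by rewrite expf_neq0 ?lead_coef_eq0.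
(* [Q] contains no nonzero constant, so [g] has positive degree and quotients by [g] are strictly
   smaller. *)
have sg : (1 < size g)%N.
  rewrite ltnNge; apply/negP=> /size1_polyC gE.
  by move: Qg gn0; rewrite gE => /QC ->; rewrite eqxx.
have Pg : P g.
  have [k] := ubnP (size f0); elim: k f0 Pf0 f0n0 => // k IHk f Pf fn0 lek.
  have E := dvdg f (PQ _ Pf).
  have qg : P ((f %/ g) * g).
    by rewrite -E -mul_polyC; case: Pcl => _ _; apply.
  case: (Ppr _ _ qg) => // Pq; apply: (IHk (f %/ g)) => //.
    apply: contra_eq_neq E => ->; rewrite mul0r scale_poly_eq0.
    by rewrite negb_or lcn0.
  have sf : (0 < size f)%N by rewrite size_poly_gt0.
  apply: (leq_trans _ (lek : (size f <= k)%N)); rewrite size_divp //.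
  by rewrite ltn_subrL sf andbT -subn1 subn_gt0.
move=> f Qf; have := dvdg f Qf; rewrite -mul_polyC => E.
have : P ((lead_coef g ^+ Pdiv.Idomain.scalp f g)%:P * f).
  by rewrite E; case: Pcl => _ _; apply.
by case/Ppr => // /PQ/QC/eqP; rewrite (negPf (lcn0 _)).
Qed.

End PolyChain.

Section BivariateChain.
Variable B : idomainType.
Local Notation T := {poly {poly B}}.
Implicit Types (P Q : T -> Prop).

Lemma prime_closed_preim (R S : comNzRingType) (h : {rmorphism R -> S})
  (P : S -> Prop) : prime_closed P -> prime_closed (fun u => P (h u)).
Proof.
case=> [[P0 PD PM] P1 Ppr]; split; [split|by rewrite rmorph1|].
- by rewrite rmorph0.
- by move=> u v Pu Pv; rewrite rmorphD; apply: PD.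
- by move=> c u Pu; rewrite rmorphM; apply: PM.
- by move=> u v; rewrite rmorphM; apply: Ppr.
Qed.

(** The second hypothesis says that [Q] lies in (x, y). So a polynomial in x alone that belongs to
    [Q] has no constant term, and its factor x can be stripped off by primality. *)
Lemma prime_const_eq0 Q : prime_closed Q ->
  (forall f, Q f -> f`_0`_0 = 0) -> ~ Q 'X%:P -> forall c, Q c%:P -> c = 0.
Proof.
move=> [_ _ Qpr] Q0 nQX c; elim/poly_ind: c => [//|c a IHc] Qc.
have a0 : a = 0 by have := Q0 _ Qc; rewrite coefC eqxx coefD coefMX coefC add0r.
move: Qc; rewrite a0 addr0 polyCM => /Qpr[/IHc -> | //].
by rewrite mul0r.
Qed.

(* [Q] meets one of the two coordinate subrings B[x], B[y] trivially, so that
   [prime_chain_const] applies over that subring. *)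
Lemma prime_chain_lt2 P Q : prime_closed P -> prime_closed Q ->
  (forall f, P f -> Q f) -> (exists2 f, P f & f != 0) ->
  (forall f, Q f -> f`_0`_0 = 0) ->
  (Q 'X%:P /\ Q 'X) \/ (forall f, Q f -> P f).
Proof.
move=> Ppr Qpr PQ Pn0 Q0; have [QX|nQX] := pselect (Q 'X%:P); last first.
  by right; apply: prime_chain_const (prime_const_eq0 Qpr Q0 nQX) PQ Pn0.
have [QY|nQY] := pselect (Q 'X); [by left | right => f].
(* Now x is in [Q] and y is not; exchanging the variables reduces to the case already settled. *)
pose sw P := fun f : T => P (swapXY f).
have Psw P' : prime_closed P' -> prime_closed (sw P').
  exact: (@prime_closed_preim T T (@swapXY B)).
have swX g : Q g -> sw Q (swapXY g) by rewrite /sw swapXYK.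
have swPQ g : sw P g -> sw Q g by apply: PQ.
have swC c : sw Q c%:P -> c = 0.
  apply: (prime_const_eq0 (Psw _ Qpr)) => [g /Q0|]; first by rewrite coef_swapXY.
  by rewrite /sw swapXY_Y.
have swn0 : exists2 g, sw P g & g != 0.
  by case: Pn0 => g Pg gn0; exists (swapXY g); rewrite ?swapXY_eq0 // /sw swapXYK.
move=> /swX /(prime_chain_const (Psw _ Ppr) (Psw _ Qpr) swC swPQ swn0).
by rewrite /sw swapXYK.
Qed.

End BivariateChain.

(** * Linear coordinates *)

(** As [A] has full row rank, it is [col_ebase A] times the top rows of [row_ebase A]. Bordering
    [col_ebase A] by an identity block makes the product invertible with [A] on top. *)
Lemma complete_basis (K : fieldType) (m : nat) (u v : 'rV[K]_m.+2) :
  row_free (col_mx u v) ->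
  exists N : 'M[K]_m.+2,
    [/\ N \in unitmx, row ord0 N = u & row (lift ord0 ord0) N = v].
Proof.
move=> fr; pose A : 'M_(1 + 1, (1 + 1) + m) := col_mx u v.
pose E : 'M_((1 + 1) + m) := block_mx (col_ebase A) 0 0 1%:M.
pose N : 'M_((1 + 1) + m) := E *m row_ebase A.
have NA : usubmx N = A.
  rewrite -[RHS]mulmx_ebase (eqP (fr : row_free A)) pid_mx_row mul_mx_row.
  by rewrite mulmx1 mulmx0 /N /E block_mxEv mul_col_mx col_mxKu.
have E1 : N \in unitmx.
  rewrite unitmx_mul row_ebase_unit andbT unitmxE det_ublock det1 mulr1.
  by rewrite -unitmxE col_ebase_unit.
have NE i k : N (lshift m i) k = A i k.
  by have := congr1 (fun M : 'M_(1 + 1, _) => M i k) NA; rewrite mxE.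
exists N; split=> //; apply/rowP=> k; rewrite mxE.
- have -> : u 0 k = A (lshift 1 0) k by rewrite col_mxEu.
  by rewrite -NE; congr (N _ _); apply: val_inj.
- have -> : v 0 k = A (rshift 1 0) k by rewrite col_mxEd.
  by rewrite -NE; congr (N _ _); apply: val_inj.
Qed.

Section LinearForms.
Variables (K : fieldType) (n : nat).
Local Notation S := {mpoly K[n]}.

Definition linear_form (c : 'rV[K]_n) : S := \sum_k c 0 k *: 'X_k.
Definition coef_row (p : S) : 'rV[K]_n := \row_k p@_(U_(k))%MM.

Lemma linear_formE p : p \is 1.-homog -> p = linear_form (coef_row p).
Proof.
move=> /dhomogP hp; apply/mpolyP=> m; rewrite /linear_form raddf_sum /=.
under eq_bigr do rewrite mcoeffZ mcoeffX mxE.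
have [/mdeg1P[i /eqP ->]|md] := boolP (mdeg m == 1%N).
  rewrite (bigD1 i) //= eqxx mulr1 big1 ?addr0 // => j ji.
  by rewrite eq_mnm1 (negPf ji) mulr0.
rewrite big1 => [|k _]; first by apply: memN_msupp_eq0; apply: contra md => /hp /eqP.
by case: (eqVneq U_(k)%MM m) md => [<-|]; rewrite ?mdeg1 ?mulr0.
Qed.

Lemma linear_formD a b c d :
  linear_form (a *: c + b *: d) = a *: linear_form c + b *: linear_form d.
Proof.
rewrite /linear_form !scaler_sumr -big_split; apply: eq_bigr => k _ /=.
by rewrite !mxE scalerDl !scalerA.
Qed.

Lemma mderiv_linear_form c k : (linear_form c)^`M(k) = (c 0 k)%:MP.
Proof.
have mm0 : (U_(k) - U_(k) = 0)%MM by apply/mnmP=> i; rewrite mnmBE subnn mnm0E.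
rewrite raddf_sum /= (bigD1 k) //= big1 ?addr0 => [|j jk].
  by rewrite mderivZ mderivX mnm1E eqxx scale1r mm0 mpolyX0 -mul_mpolyC mulr1.
by rewrite mderivZ mderivX mnm1E (negPf jk) scale0r scaler0.
Qed.

Lemma meval_linear_form c (v : 'rV[K]_n) :
  (linear_form c).@[v 0] = (c *m v^T) 0 0.
Proof.
rewrite raddf_sum mxE; apply: eq_bigr => k _.
by rewrite /= mevalZ mevalXU mxE.
Qed.

Lemma linear_form_homog c : linear_form c \is 1.-homog.
Proof.
by apply: rpred_sum => k _; apply: rpredZ; rewrite dhomogX /= mdeg1.
Qed.

End LinearForms.

Lemma rmorph_mpoly_ext (K : comNzRingType) (n : nat) (R : comNzRingType)
  (g h : {rmorphism {mpoly K[n]} -> R}) :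
  (forall c, g c%:MP = h c%:MP) -> (forall i, g 'X_i = h 'X_i) -> g =1 h.
Proof.
move=> ghC ghX p; rewrite [p]mpolyE !rmorph_sum; apply: eq_bigr => m _.
rewrite -mul_mpolyC mpolyXE_id !rmorphM !rmorph_prod ghC /=; congr (_ * _).
by apply: eq_bigr => i _; rewrite !rmorphXn ghX.
Qed.

(** * Coordinates adapted to two independent linear forms *)

Section PlaneCoordinates.
Variables (K : fieldType) (m : nat).
Local Notation S := {mpoly K[m.+2]}.
Local Notation T := {poly {poly {mpoly K[m]}}}.

Definition plane_const : {rmorphism K -> T} := polyC \o polyC \o @mpolyC m K.

(** Coordinate 0 becomes the inner variable x, coordinate 1 the outer variable y; the others go to
    the coefficient ring. *)
Definition plane_coord (k : 'I_m.+2) : T :=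
  if unlift ord0 k is Some k' then
    if unlift ord0 k' is Some j then ('X_j)%:P%:P else 'X
  else 'X%:P.

Variable N : 'M[K]_m.+2.

Definition plane_row (k : 'I_m.+2) : S := linear_form (row k N).

Definition of_plane0 : {rmorphism {mpoly K[m]} -> S} :=
  mmap (@mpolyC m.+2 K) (fun j => plane_row (lift ord0 (lift ord0 j))).

Definition of_plane1 : {rmorphism {poly {mpoly K[m]}} -> S} :=
  horner_morph (fun a => mulrC (plane_row ord0) (of_plane0 a)).

Definition of_plane : {rmorphism T -> S} :=
  horner_morph (fun a => mulrC (plane_row (lift ord0 ord0)) (of_plane1 a)).

(** The rows of [N] are the new coordinates, so the old variables are expressed in them by
    [invmx N]. *)
Definition to_plane : {rmorphism S -> T} :=
  mmap plane_const (fun j => \sum_k plane_const (invmx N j k) * plane_coord k).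

Hypothesis uN : N \in unitmx.

Lemma to_planeC c : to_plane c%:MP = plane_const c.
Proof. exact: mmapC. Qed.

Lemma to_plane_row k : to_plane (plane_row k) = plane_coord k.
Proof.
rewrite /plane_row /linear_form rmorph_sum /=.
pose E j i := plane_const (N k j * invmx N j i) * plane_coord i.
transitivity (\sum_j \sum_i E j i).
  apply: eq_bigr => j _; rewrite -mul_mpolyC rmorphM /= to_planeC mxE.
  rewrite mmapX mmap1U mulr_sumr; apply: eq_bigr => i _.
  by rewrite /E rmorphM mulrA.
rewrite exchange_big -[RHS]mul1r -(rmorph1 plane_const).
have rowE i : \sum_j E j i = plane_const (k == i)%:R * plane_coord i.
  rewrite -mulr_suml; congr (_ * _).
  have := congr1 (fun M : 'M_m.+2 => M k i) (mulmxV uN); rewrite !mxE => <-.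
  by rewrite rmorph_sum.
under eq_bigr do rewrite rowE.
rewrite (bigD1 k) //= eqxx big1 ?addr0 // => i ik.
by rewrite eq_sym (negPf ik) rmorph0 mul0r.
Qed.

Lemma of_plane_const c : of_plane (plane_const c) = c%:MP.
Proof. by rewrite /= horner_morphC /= horner_morphC /= mmapC. Qed.

Lemma of_plane_coord k : of_plane (plane_coord k) = plane_row k.
Proof.
rewrite /plane_coord; case: unliftP => [k' ->|->] /=; last first.
  by rewrite horner_morphC /= horner_morphX.
case: unliftP => [j ->|->] /=; last exact: horner_morphX.
by rewrite horner_morphC /= horner_morphC /= mmapX mmap1U.
Qed.

Lemma to_planeK : cancel to_plane of_plane.
Proof.
apply: (@rmorph_mpoly_ext _ _ _ (of_plane \o to_plane : {rmorphism S -> S}) idfun) => [c|j].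
  by change (of_plane (to_plane c%:MP) = c%:MP); rewrite to_planeC of_plane_const.
change (of_plane (to_plane 'X_j) = 'X_j).
have -> : to_plane 'X_j = \sum_k plane_const (invmx N j k) * plane_coord k.
  by rewrite /= mmapX mmap1U.
rewrite rmorph_sum.
under eq_bigr do rewrite rmorphM of_plane_const of_plane_coord /plane_row /linear_form mulr_sumr.
rewrite exchange_big /=.
have colE i : \sum_k (invmx N j k)%:MP * (row k N 0 i *: 'X_i) = (j == i)%:R%:MP * 'X_i :> S.
  have := congr1 (fun M : 'M_m.+2 => M j i) (mulVmx uN); rewrite !mxE => <-.
  rewrite rmorph_sum mulr_suml; apply: eq_bigr => k _.
  by rewrite /= mxE -mul_mpolyC rmorphM /= mulrA.
under eq_bigr do rewrite colE.
rewrite (bigD1 j) //= eqxx mpolyC1 mul1r big1 ?addr0 // => i ij.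
by rewrite eq_sym (negPf ij) mpolyC0 mul0r.
Qed.

(** The image is closed under sums and products and contains constants and coordinates. Together
    with [to_planeK], surjectivity makes the two maps mutually inverse. *)
Lemma to_plane_surj t : exists s, to_plane s = t.
Proof.
pose im t := exists s, to_plane s = t.
have imD a b : im a -> im b -> im (a + b).
  by case=> s <- [s' <-]; exists (s + s'); rewrite rmorphD.
have imM a b : im a -> im b -> im (a * b).
  by case=> s <- [s' <-]; exists (s * s'); rewrite rmorphM.
have imX k : im (plane_coord k) by exists (plane_row k); apply: to_plane_row.
have imC c : im (plane_const c) by exists c%:MP; apply: to_planeC.
have im0 : im 0 by exists 0; rewrite rmorph0.
have imx : im 'X%:P by have := imX ord0; rewrite /plane_coord unlift_none.
have imy : im 'X.
  by have := imX (lift ord0 ord0); rewrite /plane_coord liftK unlift_none.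
have im1 : im 1 by exists 1; rewrite rmorph1.
have imX' j : im ('X_j)%:P%:P.
  by have := imX (lift ord0 (lift ord0 j)); rewrite /plane_coord !liftK.
have polyC2M (p q : {mpoly K[m]}) : (p * q)%:P%:P = p%:P%:P * q%:P%:P :> T.
  exact: (rmorphM (polyC \o polyC)).
have polyC2D (p q : {mpoly K[m]}) : (p + q)%:P%:P = p%:P%:P + q%:P%:P :> T.
  exact: (rmorphD (polyC \o polyC)).
have imB b : im b%:P%:P.
  elim/mpolyind: b => [|c mm p _ _ imp]; first by have := imC 0; rewrite /= mpolyC0.
  rewrite -mul_mpolyC polyC2D polyC2M; apply/imD => //; apply/imM; first exact: imC.
  rewrite mpolyXE_id; apply: (big_ind (fun p => im p%:P%:P)) => [|a b|j _].
  - by have := imC 1; rewrite /= mpolyC1.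
  - by rewrite polyC2M; apply: imM.
  - elim: (mm j) => [|e IHe]; first by have := imC 1; rewrite /= mpolyC1 expr0.
    rewrite (exprS 'X_j e) (polyC2M 'X_j); exact: imM (imX' j) IHe.
change (im t); elim/poly_ind: t => [|t a imt]; first exact: im0.
apply: (imD _ _ (imM _ _ imt imy)).
elim/poly_ind: a => [|a b ima]; first exact: (imB 0).
rewrite polyCD polyCM; exact: (imD _ _ (imM _ _ ima imx) (imB b)).
Qed.

End PlaneCoordinates.

(* [S] is a polynomial ring in [x] and [y] over [B]. *)
Definition plane_iso (K : fieldType) (S : comNzRingType) (B : idomainType)
    (iS : {rmorphism K -> S}) (iB : {rmorphism K -> B}) (x y : S) : Prop :=
  exists (phi : {rmorphism S -> {poly {poly B}}})
         (psi : {rmorphism {poly {poly B}} -> S}),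
  [/\ cancel phi psi, cancel psi phi, forall c, phi (iS c) = (iB c)%:P%:P,
      phi x = 'X%:P & phi y = 'X].

Lemma plane_iso_linear_forms (K : fieldType) (m : nat) (u v : 'rV[K]_m.+2) :
  row_free (col_mx u v) ->
  plane_iso (@mpolyC m.+2 K) (@mpolyC m K) (linear_form u) (linear_form v).
Proof.
case/complete_basis=> N [uN <- <-]; exists (to_plane N), (of_plane N).
have K1 := to_planeK uN; split.
- exact: K1.
- by move=> t; have [s <-] := to_plane_surj uN t; rewrite K1.
- by move=> c; apply: to_planeC.
- by have := to_plane_row uN ord0; rewrite /plane_coord unlift_none.
- by have := to_plane_row uN (lift ord0 ord0); rewrite /plane_coord liftK unlift_none.
Qed.

(** * The ideal (x, y) and the Jacobian ideal of a pencil *)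

Lemma size_prod_linear (C : idomainType) (T : finType) (D : {set T})
  (f : T -> {poly C}) : {in D, forall t, size (f t) = 2} ->
  size (\prod_(t in D) f t) = #|D|.+1.
Proof.
move=> f2; rewrite size_prod => [|t tD]; last by rewrite -size_poly_eq0 f2.
by rewrite (eq_bigr (fun=> 2)) // sum_nat_const muln2 -addnn subSn ?leq_addr // addnK.
Qed.

(* Only the cofactor omitting the form [z], which has no ['X]-term, attains
   the top degree. *)
Lemma lead_coef_cofactor_sum (C : idomainType) (T : finType) (D : {set T})
  (i : T) (z : C) (a b : T -> C) (f : T -> {poly C}) : i \in D ->
  {in D, forall t, f t = (a t * z)%:P + b t *: 'X} -> a i = 1 -> b i = 0 ->
  {in D :\ i, forall t, b t != 0} ->
  lead_coef (\sum_(t in D) (a t)%:P * \prod_(r in D :\ t) f r)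
  = \prod_(t in D :\ i) b t.
Proof.
move=> iD fE ai bi bn0.
have szf t : t \in D :\ i -> size (f t) = 2 /\ lead_coef (f t) = b t.
  move=> tDi; have [_ tD] := setD1P tDi; have bt := bn0 t tDi.
  have szX : size (b t *: 'X : {poly C}) = 2.
    by rewrite size_scale // size_polyX.
  have lt : (size (a t * z)%:P < size (b t *: 'X : {poly C}))%N.
    by rewrite szX ltnS size_polyC_leq1.
  rewrite fE // addrC size_polyDl ?lead_coefDl // szX.
  by rewrite lead_coefZ lead_coefX mulr1.
have szi := size_prod_linear (fun t tD => proj1 (szf t tD)).
rewrite (big_setD1 i) //= ai mul1r lead_coefDl.
  by rewrite lead_coef_prod; apply: eq_bigr => t /szf[].
rewrite szi ltnS; elim/big_ind: _ => [|p q p_le q_le|t tDi].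
- by rewrite size_poly0.
- by rewrite (leq_trans (size_polyD _ _)) // geq_max p_le.
have [ti tD] := setD1P tDi.
rewrite (big_setD1 i) /= ?inE 1?eq_sym ?ti // fE // ai bi scale0r addr0 mul1r.
rewrite mulrA -polyCM mul_polyC (leq_trans (size_scale_leq _ _)) //.
rewrite setDDl setUC -setDDl size_prod_linear.
  by rewrite [X in (_ <= X)%N](cardsD1 t) tDi.
by move=> r /setD1P[_ /szf[]].
Qed.

Lemma prime_ideal_ker (R : comNzRingType) (C : idomainType)
  (h : {rmorphism R -> C}) : is_prime_ideal [pred f | h f == 0].
Proof.
split; [split|].
- by rewrite inE rmorph0.
- by rewrite inE rmorph1 oner_eq0.
- by move=> c f g /eqP f0 /eqP g0; rewrite inE rmorphD rmorphM f0 g0 mulr0 addr0.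
- by move=> f g; rewrite !inE rmorphM mulf_eq0.
Qed.

Lemma is_prime_ideal_closed (R : comNzRingType) (P : {pred R}) :
  is_prime_ideal P -> prime_closed (fun f => f \in P).
Proof.
case=> Pid Ppr; split; first exact: ideal_closed_proper.
  by case: Pid => _ /negP.
by move=> f g /Ppr/orP.
Qed.

Lemma not_subset_ex (R : Type) (P Q : {pred R}) :
  ~ {subset P <= Q} -> exists2 f, f \in P & f \notin Q.
Proof.
by move=> PQ; apply: contrapT => nex; apply: PQ => f fP; apply: contrapT => /negP fQ;
  apply: nex; exists f.
Qed.

Section Plane.
Variables (K : fieldType) (S : comNzRingType) (B : idomainType).
Local Notation T := {poly {poly B}}.
Variables (iS : {rmorphism K -> S}) (iB : {rmorphism K -> B}) (x y : S).
Local Notation I := (ideal_gen [:: x; y]).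
Variables (phi : {rmorphism S -> T}) (psi : {rmorphism T -> S}).
Hypotheses (phiK : cancel phi psi) (psiK : cancel psi phi).
Hypotheses (phiC : forall c, phi (iS c) = (iB c)%:P%:P).
Hypotheses (phix : phi x = 'X%:P) (phiy : phi y = 'X).

Lemma plane_decomp f : exists q q',
  f = psi ((phi f)`_0`_0)%:P%:P + q * x + q' * y.
Proof.
pose t := phi f; pose c := t`_0.
exists (psi (drop_poly 1 c)%:P), (psi (drop_poly 1 t)).
rewrite -[LHS]phiK -[x]phiK -[y]phiK phix phiy -!rmorphM -!rmorphD; congr (psi _).
have take1 (R : nzRingType) (p : {poly R}) : take_poly 1 p = (p`_0)%:P.
  by apply/polyP=> k; rewrite coef_take_poly coefC; case: k.
rewrite -{1}[phi f](poly_take_drop 1) expr1 take1; congr (_ + _).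
rewrite /=; congr _%:P.
by rewrite -[LHS](poly_take_drop 1) expr1 take1.
Qed.

Lemma mem_planeP f : f \in I <-> (phi f)`_0`_0 = 0.
Proof.
rewrite ideal_gen2P; split=> [[c [d ->]]|f0].
  rewrite rmorphD !rmorphM /= phix phiy coefD !coef0M coefX mulr0 addr0.
  by rewrite coef0M coefC eqxx coefX mulr0.
have [q [q' ->]] := plane_decomp f; exists q, q'.
by rewrite f0 rmorph0 add0r.
Qed.


Lemma plane_prime : is_prime_ideal I.
Proof.
(* The ideal is the kernel of evaluation at x = y = 0, with values in the domain [B]. *)
have -> : I = [pred f | (coefp 0 \o (coefp 0 \o phi)) f == 0].
  by apply/funext=> f; apply/idP/eqP => /mem_planeP.
exact: prime_ideal_ker.
Qed.

(** In such a chain, [C 1] is nonzero and [C 2] lies in (x, y). By [prime_chain_lt2], either [C 2]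
    is all of (x, y) or it is contained in [C 1]; both contradict strictness. *)
Lemma plane_height_lt3 : ~ prime_height_ge I 3.
Proof.
case=> C [Cpr Cs C3].
have pr k : (k <= 3)%N -> prime_closed (fun t => psi t \in C k).
  by move=> k3; apply: (@prime_closed_preim _ _ psi _ (is_prime_ideal_closed (Cpr k k3))).
have [[C01 nC10] [C12 nC21] [C23 nC32]] := And3 (Cs 0 isT) (Cs 1 isT) (Cs 2 isT).
have [f f1 f0] := not_subset_ex nC10.
have fn0 : phi f != 0.
  apply: contraNneq f0 => f0; rewrite -[f]phiK f0 rmorph0.
  by have [[]] := Cpr 0 isT.
case: (prime_chain_lt2 (pr 1 isT) (pr 2 isT)) => [t /C12 //| |t /C23|[Cx Cy]|C21].
- by exists (phi f); rewrite ?phiK.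
- by rewrite C3 => /mem_planeP; rewrite psiK.
- rewrite -phix phiK in Cx; rewrite -phiy phiK in Cy.
  apply: nC32 => g; rewrite C3; apply: (@ideal_gen_min _ _ (fun h => h \in C 2)) => [|h].
    by apply: ideal_closed_proper; case: (Cpr 2 isT).
  by rewrite !inE => /orP[] /eqP ->.
- by apply: nC21 => g; rewrite -[g]phiK => /C21.
Qed.

(** The ideal (x), as the kernel of setting x = 0: the middle term of a chain from 0 to (x, y). *)
Lemma plane_subprime : exists P : {pred S},
  [/\ is_prime_ideal P, {subset P <= I}, x \in P & y \notin P].
Proof.
exists ([pred f | (map_poly (coefp 0) \o phi) f == 0] : {pred S}); split.
- exact: prime_ideal_ker.
- move=> f; rewrite inE /= => /eqP f0; apply/mem_planeP.
  by have /polyP/(_ 0) := f0; rewrite (coef_map (coefp 0)) coef0.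
- by rewrite inE /= phix (map_polyC (coefp 0)) /= coefX.
- by rewrite inE /= phiy (map_polyX (coefp 0)) polyX_eq0.
Qed.

(** * The ideal (A, A') of a pencil of forms in x and y *)

Section Pencil.
Variables (T0 : finType) (l : T0 -> S) (D : {set T0}) (i : T0) (a b : T0 -> K).
Hypotheses (iD : i \in D) (ai : a i = 1) (bi : b i = 0).
Hypothesis lE : {in D, forall t, l t = iS (a t) * x + iS (b t) * y}.
Hypothesis bn0 : {in D :\ i, forall t, b t != 0}.

Local Notation cofactor t := (\prod_(r in D :\ t) l r).
Local Notation A := (\sum_(t in D) iS (a t) * cofactor t).
Local Notation A' := (\sum_(t in D) iS (b t) * cofactor t).

(** Since l_i = x is the only form without y, its cofactor alone reaches the top degree in y; the
    leading coefficient of [A] is the product of the remaining b_t. *)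
Lemma pencil_monic : exists2 g, g \is monic &
  exists2 c : K, c != 0 & phi A = (iB c)%:P%:P * g.
Proof.
pose c := \prod_(t in D :\ i) b t.
have c0 : c != 0 by apply/prodf_neq0 => t; apply: bn0.
have lcA : lead_coef (phi A) = (iB c)%:P.
  rewrite rmorph_sum; under eq_bigr do rewrite rmorphM rmorph_prod phiC.
  rewrite (lead_coef_cofactor_sum (z := 'X)
    (a := fun t => (iB (a t))%:P) (b := fun t => (iB (b t))%:P) iD).
  - by rewrite /c !rmorph_prod.
  - move=> t tD; rewrite lE // rmorphD !rmorphM /= !phiC phix phiy.
    by rewrite -mul_polyC.
  - by rewrite ai rmorph1.
  - by rewrite bi rmorph0.
  - by move=> t /bn0; rewrite polyC_eq0 fmorph_eq0.
have cV (d : K) : d != 0 -> (iB d)%:P%:P * (iB d^-1)%:P%:P = 1 :> T.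
  by move=> d0; rewrite -!rmorphM divff ?rmorph1.
exists ((iB c^-1)%:P%:P * phi A); last first.
  by exists c => //; rewrite mulrA cV // mul1r.
rewrite mul_polyC monicE lead_coefZ lcA; have := cV c c0.
by rewrite -polyCM mulrC => /polyC_inj ->.
Qed.

(** The part b0 of w free of x and y is nonzero as w is outside (x, y). Because x and y are
    nilpotent modulo J, a power of b0 also multiplies c into J, and [unmixed_monic] applies. *)
Lemma pencil_unmixed w c k e : x ^+ k \in ideal_gen [:: A; A'] ->
  y ^+ e \in ideal_gen [:: A; A'] -> w \notin I ->
  w * c \in ideal_gen [:: A; A'] -> c \in ideal_gen [:: A; A'].
Proof.
set J := ideal_gen _ => Jx Jy wI Jwc; have Jcl : ideal_closed (fun f => f \in J).
  exact: ideal_gen_closed.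
have JMl f g : g \in J -> f * g \in J by case: Jcl => _ _; apply.
have JMr f g : f \in J -> f * g \in J by rewrite mulrC; apply: JMl.
pose b0 := (phi w)`_0`_0; have b0n0 : b0 != 0.
  by apply: contraNneq wI => /mem_planeP.
have [q [q' wE]] := plane_decomp w.
have Jccl := ideal_closed_colon c Jcl.
have [n Jn] : exists n, psi (b0 ^+ n)%:P%:P * c \in J.
  (* Modulo the colon ideal of J by c, b0 + q' y equals -q x, whose k-th power vanishes. So b0^k is
     a multiple of y there, and its e-th power vanishes. *)
  exists (k * e)%N; rewrite exprM.
  pose z := psi b0%:P%:P.
  have zE n : psi (b0 ^+ n)%:P%:P = z ^+ n by rewrite /z -!rmorphXn.
  have Jz : (z + q' * y) ^+ k * c \in J.
    apply: (ideal_closed_exp_sub (I := fun f => f * c \in J) (c := q * x)) => //.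
      by rewrite addrAC -wE.
    by rewrite exprMn -mulrA JMl // JMr.
  have [r zr] : exists r, (z + q' * y) ^+ k = z ^+ k + r * y.
    exists (q' * \sum_(j < k) (z + q' * y) ^+ (k.-1 - j) * z ^+ j).
    have /eqP := subrXX (z + q' * y) z k.
    by rewrite addrAC subrr add0r subr_eq [_ + z ^+ k]addrC mulrAC => /eqP.
  rewrite -exprM zE exprM.
  apply: (ideal_closed_exp_sub (I := fun f => f * c \in J) (c := r * y)) => //.
    by rewrite -zr.
  by rewrite exprMn -mulrA JMl // JMr.
have [g gm [d d0 AE]] := pencil_monic.
have /ideal_gen2P[p [p' xE]] := Jx; have /ideal_gen2P[r [r' rE]] := Jn.
have [] := @unmixed_monic _ g (phi A') (phi c) (phi p') (phi p * (iB d)%:P%:P)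
  (phi r * (iB d)%:P%:P) (phi r') (b0 ^+ n) k gm.
- exact: expf_neq0.
- rewrite rmorphXn /= -phix -rmorphXn xE rmorphD !rmorphM /= AE; ring.
- by rewrite -[_%:P%:P]psiK -rmorphM rE rmorphD !rmorphM AE; ring.
move=> h [h' hE]; apply/ideal_gen2P.
exists (psi h * iS d^-1), (psi h').
rewrite -[LHS]phiK hE; apply: (can_inj phiK).
rewrite psiK rmorphD !rmorphM !psiK phiC AE addrC; congr (_ + _).
have dV : (iB d^-1)%:P%:P * (iB d)%:P%:P = 1 :> T by rewrite -!rmorphM mulVf ?rmorph1.
by rewrite mulrA -(mulrA h) dV mulr1.
Qed.

Lemma pencil_form_mem t : t \in D -> l t \in I.
Proof. by move=> tD; apply/ideal_gen2P; exists (iS (a t)), (iS (b t)); rewrite lE. Qed.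

Lemma pencil_sub : (1 < #|D|)%N -> {subset ideal_gen [:: A; A'] <= I}.
Proof.
move=> D1; have Icl := ideal_gen_closed [:: x; y].
have cofI t : t \in D -> cofactor t \in I.
  move=> tD; have : (0 < #|D :\ t|)%N by move: D1; rewrite (cardsD1 t) tD.
  case/card_gt0P=> r rDt; rewrite (big_setD1 r) //=.
  have [_ rD] := setD1P rDt.
  by rewrite mulrC; case: Icl => _ _; apply; apply: pencil_form_mem.
move=> f; apply: (@ideal_gen_min _ _ (fun h => h \in I)) => // g.
by rewrite !inE => /orP[] /eqP ->;
  apply: (@ideal_closed_sum _ (fun h => h \in I)) => // t tD;
  case: Icl => _ _; apply; apply: cofI.
Qed.

(** If A' c is a multiple of [A], so is x^k c, because x^k is in (A, A'). Up to a constant [A] is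
    monic in y, so x^k can be cancelled. *)
Lemma pencil_regular k : (1 < #|D|)%N -> x ^+ k \in ideal_gen [:: A; A'] ->
  regular_sequence [:: A; A'].
Proof.
move=> D1 Jx; have [g gm [d d0 AE]] := pencil_monic.
have dV : (iB d^-1)%:P%:P * (iB d)%:P%:P = 1 :> T by rewrite -!rmorphM mulVf ?rmorph1.
split.
  have [[_ nI _] _] := plane_prime; apply: contra nI; exact: pencil_sub.
case=> [|[|//]] _ c /=.
  case/asboolP=> ?; rewrite big_ord0 => Ac0.
  have d1 : (iB d)%:P%:P != 0 :> T by rewrite !polyC_eq0 fmorph_eq0.
  have /eqP : phi (A * c) = 0 by rewrite Ac0 rmorph0.
  rewrite rmorphM AE !mulf_eq0 (negPf d1) (negPf (monic_neq0 gm)) /= => /eqP c0.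
  by apply/asboolP; exists (fun=> 0); rewrite big_ord0 -[c]phiK c0 rmorph0.
case/ideal_gen1P=> q cE; have /ideal_gen2P[p [p' xE]] := Jx.
have [||r rE] := @monic_dvd_scale _ g (phi c) 'X^k
    ((phi p * phi c + phi p' * phi q) * (iB d)%:P%:P) gm.
- by rewrite monic_neq0 ?monicXn.
- rewrite -mul_polyC rmorphXn /= -phix -rmorphXn xE.
  have cE' : phi A' * phi c = phi q * ((iB d)%:P%:P * g) by rewrite -rmorphM cE rmorphM AE.
  by rewrite rmorphD !rmorphM mulrDl -(mulrA (phi p')) cE' AE; ring.
apply/ideal_gen1P; exists (psi r * iS d^-1).
by apply: (can_inj phiK); rewrite !rmorphM psiK phiC AE rE mulrA -(mulrA r) dV mulr1.
Qed.

End Pencil.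

End Plane.

Section PlaneIso.
Variables (K : fieldType) (S : comNzRingType) (B : idomainType).
Variables (iS : {rmorphism K -> S}) (iB : {rmorphism K -> B}) (x y : S).
Hypothesis iso : plane_iso iS iB x y.
Local Notation I := (ideal_gen [:: x; y]).

Lemma plane_iso_line :
  [/\ is_prime_ideal I, ~ prime_height_ge I 3
    & exists P : {pred S},
      [/\ is_prime_ideal P, {subset P <= I}, x \in P & y \notin P]].
Proof.
have [phi [psi [phiK psiK _ phix phiy]]] := iso; split.
- exact: plane_prime phiK phix phiy.
- exact: plane_height_lt3 phiK psiK phix phiy.
- exact: plane_subprime phiK phix phiy.
Qed.

Lemma plane_iso_pencil (T : finType) (l : T -> S) (D : {set T}) (i : T)
  (a b : T -> K) k e : i \in D -> a i = 1 -> b i = 0 ->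
  {in D, forall t, l t = iS (a t) * x + iS (b t) * y} ->
  {in D :\ i, forall t, b t != 0} -> (1 < #|D|)%N ->
  let J := ideal_gen [:: \sum_(t in D) iS (a t) * \prod_(r in D :\ t) l r;
                         \sum_(t in D) iS (b t) * \prod_(r in D :\ t) l r] in
  x ^+ k \in J -> y ^+ e \in J ->
  [/\ forall w c, w \notin I -> w * c \in J -> c \in J, {subset J <= I}
    & regular_sequence [:: \sum_(t in D) iS (a t) * \prod_(r in D :\ t) l r;
                           \sum_(t in D) iS (b t) * \prod_(r in D :\ t) l r]].
Proof.
have [phi [psi [phiK psiK phiC phix phiy]]] := iso.
move=> iD ai bi lE bn0 D2 J xJ yJ; split.
- move=> w c; exact: (pencil_unmixed phiK psiK phiC phix phiy iD ai bi lE bn0 xJ yJ).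
- exact: pencil_sub lE D2.
- exact: (pencil_regular phiK psiK phiC phix phiy iD ai bi lE bn0 D2 xJ).
Qed.

End PlaneIso.

(** * Jacobian ideals of arrangements *)

Lemma mderiv_prod (R : comNzRingType) (n : nat) (T : finType) (D : {set T})
  (F : T -> {mpoly R[n]}) k :
  (\prod_(t in D) F t)^`M(k) = \sum_(t in D) (F t)^`M(k) * \prod_(r in D :\ t) F r.
Proof.
elim: {D}#|D| {-2}D (erefl #|D|) => [|c IHc] D cD.
  by rewrite (cards0_eq cD) !big_set0 -mpolyC1 mderivC.
have [s sD] : exists s, s \in D by apply/card_gt0P; rewrite cD.
rewrite (big_setD1 s) // mderivM /= [RHS](big_setD1 s) //=; congr (_ + _).
rewrite IHc; last by apply: succn_inj; rewrite -cD (cardsD1 s D) sD.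
rewrite mulr_sumr; apply: eq_bigr => t /setD1P[ts tD].
rewrite mulrCA [in RHS](big_setD1 s) /= ?inE 1?eq_sym ?ts //.
by rewrite !setDDl setUC.
Qed.

Lemma row_free2P (K : fieldType) (n : nat) (u v : 'rV[K]_n) :
  row_free (col_mx u v) <->
  forall c d, c *: u + d *: v = 0 -> c = 0 /\ d = 0.
Proof.
have E (w : 'rV[K]_(1 + 1)) :
    w *m col_mx u v = lsubmx w 0 0 *: u + rsubmx w 0 0 *: v.
  rewrite -{1}[w]hsubmxK mul_row_col [lsubmx w]mx11_scalar [rsubmx w]mx11_scalar.
  by rewrite !mul_scalar_mx !mxE.
split=> [fr c d cd|indep].
  pose w : 'rV[K]_(1 + 1) := row_mx c%:M d%:M.
  have w0 : w = 0.
    apply: (row_free_inj fr); rewrite mul0mx E row_mxKl row_mxKr !mxE eqxx.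
    by rewrite !mulr1n.
  have := congr1 lsubmx w0; have := congr1 rsubmx w0.
  rewrite row_mxKl row_mxKr !linear0 => /matrixP/(_ 0 0) + /matrixP/(_ 0 0).
  by rewrite !mxE eqxx !mulr1n => -> ->.
apply: inj_row_free => w; rewrite E => /indep[w1 w2].
rewrite -[w]hsubmxK [lsubmx w]mx11_scalar [rsubmx w]mx11_scalar w1 w2.
by rewrite !raddf0 row_mx0.
Qed.

(** [pinvmx] is a right inverse here. The vector [e] is a direction in which the two linear forms
    have prescribed derivatives. *)
Lemma row_free2_dual (K : fieldType) (n : nat) (u v : 'rV[K]_n) :
  row_free (col_mx u v) -> forall a b : K, exists e : 'cV[K]_n,
  (u *m e) 0 0 = a /\ (v *m e) 0 0 = b.
Proof.
move=> fr a b; pose w : 'cV[K]_(1 + 1) := col_mx a%:M b%:M.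
exists (pinvmx (col_mx u v) *m w).
have : col_mx u v *m (pinvmx (col_mx u v) *m w) = w by rewrite mulmxA mulmxVp ?mul1mx.
rewrite mul_col_mx => /eq_col_mx[-> ->].
by rewrite !mxE eqxx !mulr1n.
Qed.

Section Arrangement.
Variables (K : fieldType) (n s : nat) (l : 'I_s -> {mpoly K[n.+1]}).
Hypothesis charK : [pchar K] =i pred0.
Hypothesis l_linear : forall i, l i \is 1.-homog.
Hypothesis l_neq0 : forall i, l i != 0.
Hypothesis l_distinct : forall i j, hyperplane (l i) =i hyperplane (l j) -> i = j.
Implicit Types (D : {set 'I_s}) (i j t : 'I_s).

Local Notation S := {mpoly K[n.+1]}.
Local Notation row t := (coef_row (l t)).
Local Notation Lambda i j := [predI hyperplane (l i) & hyperplane (l j)].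

Definition pencil i j : {set 'I_s} :=
  [set t | l t \in vanishing_ideal (Lambda i j)].

Lemma form_rowE t : l t = linear_form (row t).
Proof. exact: linear_formE. Qed.

Lemma meval_form t (w : 'rV[K]_n.+1) : (l t).@[w 0] = (row t *m w^T) 0 0.
Proof. by rewrite {1}(form_rowE t) meval_linear_form. Qed.

Lemma row_neq0 t : row t != 0.
Proof.
apply: contraNneq (l_neq0 t) => r0; rewrite (form_rowE t) r0 /linear_form.
by rewrite big1 // => k _; rewrite mxE scale0r.
Qed.

(** Proportional nonzero forms would define the same hyperplane. *)
Lemma rows_indep i j : i != j -> row_free (col_mx (row i) (row j)).
Proof.
move=> ij; apply/row_free2P => c d cd.
have [c0|c0] := eqVneq c 0.
  move/eqP: cd; rewrite c0 scale0r add0r scaler_eq0 (negPf (row_neq0 j)) orbF.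
  by move/eqP.
have rE : row i = (- d / c) *: row j.
  rewrite mulrC -scalerA; apply: (canRL (scalerK c0)).
  by apply/eqP; rewrite scaleNr -addr_eq0 cd.
have e0 : - d / c != 0.
  by apply: contraNneq (row_neq0 i) => e0; rewrite rE e0 scale0r.
case/eqP: ij; apply: l_distinct => w.
have ev : (l i).@[w 0] = - d / c * (l j).@[w 0].
  by rewrite !meval_form rE -scalemxAl mxE.
by rewrite inE [RHS]inE ev mulf_eq0 (negPf e0).
Qed.

(** The columns of [cokermx M] are common zeros of l_i and l_j; a row killed by all of them is in
    the row space of [M]. *)
Lemma mem_pencilP i j t :
  t \in pencil i j <-> exists a b, row t = a *: row i + b *: row j.
Proof.
rewrite inE; split=> [/asboolP lt0|[a [b tE]]]; last first.
  apply/asboolP=> w /andP[/andP[_ /eqP wi] /andP[_ /eqP wj]]; move: wi wj.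
  rewrite !meval_form tE mulmxDl -!scalemxAl !mxE => -> ->.
  by rewrite !mulr0 addr0.
pose M := col_mx (row i) (row j).
have /submxP[c cE] : (row t <= M)%MS.
  rewrite submxE; apply/eqP/rowP=> k; rewrite [RHS]mxE.
  pose w := (col k (cokermx M))^T.
  have wE u : (u *m cokermx M) 0 k = (u *m w^T) 0 0.
    by rewrite trmxK !mxE; apply: eq_bigr => h _; rewrite !mxE.
  (* A zero column represents no point, but every linear form vanishes on it. *)
  rewrite wE -meval_form; have [w0|w0] := eqVneq w 0.
    rewrite meval_form w0 trmx0 mulmx0 mxE //.
  apply: lt0; rewrite !inE w0 /= !meval_form -!wE.
  have := mulmx_coker M; rewrite {1}/M mul_col_mx -[0]vsubmxK => /eq_col_mx[-> ->].
  by rewrite !linear0 !mxE eqxx.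
exists (lsubmx c 0 0), (rsubmx c 0 0).
rewrite cE -{1}[c]hsubmxK mul_row_col [lsubmx c]mx11_scalar [rsubmx c]mx11_scalar.
by rewrite !mul_scalar_mx !mxE.
Qed.

Lemma pencil_l i j : i \in pencil i j.
Proof. by apply/mem_pencilP; exists 1, 0; rewrite scale1r scale0r addr0. Qed.

Lemma pencil_r i j : j \in pencil i j.
Proof. by apply/mem_pencilP; exists 0, 1; rewrite scale1r scale0r add0r. Qed.

Lemma pencil_coords i j : i != j -> exists a b : 'I_s -> K,
  [/\ a i = 1, b i = 0,
      {in pencil i j, forall t, row t = a t *: row i + b t *: row j},
      {in pencil i j :\ i, forall t, b t != 0}
    & {in pencil i j &, forall t r, t != r -> a t * b r - a r * b t != 0}].
Proof.
move=> ij.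
have /choice[ab abE] t : exists ab : K * K,
    t \in pencil i j -> row t = ab.1 *: row i + ab.2 *: row j.
  have [/mem_pencilP[a [b tE]]|nt] := boolP (t \in pencil i j).
    by exists (a, b).
  by exists (0, 0).
exists (fun t => (ab t).1), (fun t => (ab t).2).
have [a1 b0] : (ab i).1 - 1 = 0 /\ (ab i).2 = 0.
  apply: (proj1 (row_free2P _ _) (rows_indep ij)).
  by rewrite scalerBl scale1r addrAC -(abE i (pencil_l i j)) subrr.
(* If the determinant were 0, then b_r row t = b_t row r, so b_r = b_t = 0 by independence; then a_r
   row t = a_t row r gives a_t = 0, and row t would be 0. *)
have det_neq0 : {in pencil i j &, forall t r, t != r ->
    (ab t).1 * (ab r).2 - (ab r).1 * (ab t).2 != 0}.
  move=> t r tD rD tr; apply/negP=> /eqP det0.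
  have indep := proj1 (row_free2P _ _) (rows_indep tr).
  have [b2 b1] : (ab r).2 = 0 /\ - (ab t).2 = 0.
    apply: indep; rewrite (abE t) // (abE r) //.
    transitivity (((ab t).1 * (ab r).2 - (ab r).1 * (ab t).2) *: row i).
      by apply/rowP=> k; rewrite !mxE; ring.
    by rewrite det0 scale0r.
  have tr0 : (ab r).1 *: row t + (- (ab t).1) *: row r = 0.
    rewrite (abE t) // (abE r) // b2 (oppr_inj (etrans b1 (esym (oppr0 _)))).
    by apply/rowP=> k; rewrite !mxE; ring.
  have [_ /eqP] := indep _ _ tr0; rewrite oppr_eq0 => /eqP a0.
  case/eqP: (row_neq0 t); rewrite (abE t) // a0.
  by move/eqP: b1; rewrite oppr_eq0 => /eqP ->; rewrite !scale0r addr0.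
split=> //; first by apply/eqP; rewrite -subr_eq0 a1.
(* As a_i = 1 and b_i = 0, the determinant of the pair i, t is b_t. *)
move=> t /setD1P[ti tD]; have := det_neq0 i t (pencil_l i j) tD; rewrite eq_sym b0.
by rewrite mulr0 subr0 mulf_eq0 => /(_ ti)/norP[].
Qed.

Lemma mderiv_form t k : (l t)^`M(k) = (row t 0 k)%:MP.
Proof. by rewrite {1}(form_rowE t) mderiv_linear_form. Qed.

Lemma mderiv_prod_forms D k : (\prod_(t in D) l t)^`M(k) =
  \sum_(t in D) (row t 0 k)%:MP * \prod_(r in D :\ t) l r.
Proof. by rewrite mderiv_prod; under eq_bigr do rewrite mderiv_form. Qed.

Lemma mem_jacobian (h : S) k : h^`M(k) \in jacobian_ideal h.
Proof. by apply: mem_ideal_gen; apply/map_f/mem_enum. Qed.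

Lemma jacobian_closed (h : S) : ideal_closed (fun f => f \in jacobian_ideal h).
Proof. exact: ideal_gen_closed. Qed.

Lemma jacobian_min (I : S -> Prop) (h f : S) : ideal_closed I ->
  (forall k, I h^`M(k)) -> f \in jacobian_ideal h -> I f.
Proof. by move=> Icl Ih; apply: ideal_gen_min => // _ /mapP[k _ ->]. Qed.

Lemma euler_prod D : \sum_k 'X_k * (\prod_(t in D) l t)^`M(k)
  = (\prod_(t in D) l t) *+ #|D|.
Proof.
transitivity (\sum_k \sum_(t in D) 'X_k * ((row t 0 k)%:MP * \prod_(r in D :\ t) l r)).
  by apply: eq_bigr => k _; rewrite mderiv_prod_forms mulr_sumr.
rewrite exchange_big -sumr_const; apply: eq_bigr => t tD /=.
rewrite [RHS](big_setD1 t) //= {2}(form_rowE t) mulr_suml; apply: eq_bigr => k _.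
by rewrite mulrA -mul_mpolyC [_ * 'X_k]mulrC.
Qed.

(** Euler's formula puts the product times the number of forms into the Jacobian ideal; in
    characteristic zero this number is invertible. *)
Lemma prod_mem_jacobian D : D != set0 ->
  \prod_(t in D) l t \in jacobian_ideal (\prod_(t in D) l t).
Proof.
rewrite -card_gt0 => D0; set f := \prod_(t in D) l t.
have d0 : #|D|%:R != 0 :> K by move/pcharf0P: charK => ->; rewrite -lt0n.
have fE : f = (#|D|%:R^-1)%:MP * \sum_k 'X_k * f^`M(k).
  rewrite euler_prod -/f -[f *+ _]mulr_natr mulrCA -mpolyC_nat -mpolyCM mulVf //.
  by rewrite mpolyC1 mulr1.
rewrite {1}fE; apply: ideal_gen_mull; apply: ideal_gen_sum => k _.
exact/ideal_gen_mull/mem_jacobian.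
Qed.

(** The product is in [P], hence so is some l_i. In the derivative by a variable occurring in l_i,
    all terms except the cofactor of l_i are multiples of l_i; so this cofactor is in [P] and yields
    a second form. *)
Lemma prime_jacobian (P : {pred S}) : (0 < s)%N -> is_prime_ideal P ->
  {subset jacobian_ideal (\prod_(t < s) l t) <= P} ->
  exists i j, [/\ i != j, l i \in P & l j \in P].
Proof.
move=> s0 /is_prime_ideal_closed[Pcl P1 Ppr] JP.
have prodP D : \prod_(t in D) l t \in P -> exists2 t, t \in D & l t \in P.
  elim/big_rec: _ => [//|t g tD IH /Ppr[tP|/IH //]]; by exists t.
have hE : \prod_(t < s) l t = \prod_(t in [set: 'I_s]) l t.
  by apply: eq_bigl => t; rewrite inE.
have hP : \prod_(t in [set: 'I_s]) l t \in P.
  by apply: JP; rewrite hE prod_mem_jacobian // -card_gt0 cardsT card_ord.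
have [i _ iP] := prodP _ hP; exists i.
suff /prodP[j /setD1P[ji _] jP] : \prod_(t in [set: 'I_s] :\ i) l t \in P.
  by exists j; rewrite eq_sym.
have [k rk] : exists k, row i 0 k != 0.
  by apply/existsP; apply: contraNT (row_neq0 i) => /existsPn r0;
    apply/eqP/rowP=> k; rewrite [RHS]mxE; apply/eqP; have := r0 k; rewrite negbK.
have := JP _ (mem_jacobian _ k); rewrite hE mderiv_prod_forms (big_setD1 i) ?inE //=.
set R := (X in _ + X) => dP.
have RP : R \in P.
  case: (Pcl) => P0 PD PM; apply: (big_ind (fun g => g \in P)) => // t /setD1P[ti _].
  rewrite (big_setD1 i) /= ?inE 1?eq_sym ?ti // mulrCA.
  exact: ideal_closedMr Pcl iP.
have := ideal_closedB Pcl dP RP; rewrite addrK.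
move/(ideal_closedMr (row i 0 k)^-1%:MP Pcl).
by rewrite mulrAC -mpolyCM mulfV // mpolyC1 mul1r.
Qed.

(** By the chain rule the partial derivatives are constant combinations of A and A'; derivatives in
    dual directions recover A and A'. *)
Lemma pencil_jacobian i j (a b : 'I_s -> K) : i != j ->
  {in pencil i j, forall t, row t = a t *: row i + b t *: row j} ->
  let cofactor t := \prod_(r in pencil i j :\ t) l r in
  jacobian_ideal (\prod_(t in pencil i j) l t) =i
  ideal_gen [:: \sum_(t in pencil i j) (a t)%:MP * cofactor t;
                \sum_(t in pencil i j) (b t)%:MP * cofactor t].
Proof.
move=> ij tE /=; set A := \sum_(t in _) _; set A' := \sum_(t in _) _.
set f := \prod_(t in pencil i j) l t.
have dE k : f^`M(k) = (row i 0 k)%:MP * A + (row j 0 k)%:MP * A'.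
  rewrite mderiv_prod_forms !mulr_sumr -big_split; apply: eq_bigr => t tD /=.
  rewrite [in LHS](tE t tD) !mxE !mulrA -mulrDl -!mpolyCM -mpolyCD.
  by rewrite ![_ * a t]mulrC ![_ * b t]mulrC.
have gcl := ideal_gen_closed [:: A; A']; have Jcl := jacobian_closed f.
move=> g; apply/idP/idP.
  apply: (jacobian_min gcl) => k; rewrite dE.
  by apply: ideal_genD; apply: ideal_gen_mull; apply: mem_ideal_gen; rewrite !inE eqxx ?orbT.
have dual c d : exists e : 'cV[K]_n.+1,
    \sum_k (e k 0)%:MP * f^`M(k) = c%:MP * A + d%:MP * A'.
  have [e [ie je]] := row_free2_dual (rows_indep ij) c d; exists e.
  under eq_bigr do rewrite dE mulrDr !mulrA -!mpolyCM.
  rewrite big_split -!mulr_suml -!rmorph_sum -ie -je !mxE /=.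
  by congr (_%:MP * _ + _%:MP * _); apply: eq_bigr => k _; rewrite mulrC.
have memJ c d : c%:MP * A + d%:MP * A' \in jacobian_ideal f.
  have [e <-] := dual c d; apply: ideal_gen_sum => k _.
  exact/ideal_gen_mull/mem_jacobian.
apply: (ideal_gen_min Jcl) => h; rewrite !inE => /orP[] /eqP ->.
  by have := memJ 1 0; rewrite mpolyC1 mpolyC0 mul1r mul0r addr0.
by have := memJ 0 1; rewrite mpolyC1 mpolyC0 mul1r mul0r add0r.
Qed.

Lemma prod_pencil i j : \prod_(t < s) l t =
  (\prod_(t in pencil i j) l t) * \prod_(t in ~: pencil i j) l t.
Proof.
rewrite (bigID (mem (pencil i j))) /=; congr (_ * _).
by apply: eq_bigl => t; rewrite !inE.
Qed.

(** Product rule for h = f u; f itself is in Jac(f) by Euler's formula. *)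
Lemma jacobian_sub_pencil i j :
  {subset jacobian_ideal (\prod_(t < s) l t)
       <= jacobian_ideal (\prod_(t in pencil i j) l t)}.
Proof.
set f := \prod_(t in _) l t; have Jcl := jacobian_closed f.
move=> g; apply: (jacobian_min Jcl) => k; rewrite (prod_pencil i j) mderivM.
apply: ideal_genD; apply: ideal_gen_mulr; first exact: mem_jacobian.
apply: prod_mem_jacobian.
by apply/set0Pn; exists i; apply: pencil_l.
Qed.

Lemma pencil_sub_jacobian i j g :
  g \in jacobian_ideal (\prod_(t in pencil i j) l t) ->
  g * (\prod_(t in ~: pencil i j) l t) ^+ 2 \in jacobian_ideal (\prod_(t < s) l t).
Proof.
set f := \prod_(t in _) l t; set u := \prod_(t in _) l t; set h := \prod_(t < s) l t.
have Jcl := jacobian_closed h; have hE : h = f * u by apply: prod_pencil.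
have hJ : h \in jacobian_ideal h.
  have -> : h = \prod_(t in [set: 'I_s]) l t by apply: eq_bigl => t; rewrite inE.
  by apply: prod_mem_jacobian; apply/set0Pn; exists i; rewrite inE.
apply: (jacobian_min (ideal_closed_colon (u ^+ 2) Jcl)) => k.
have -> : f^`M(k) * u ^+ 2 = h^`M(k) * u - h * u^`M(k).
  by rewrite hE mderivM; ring.
by apply: ideal_genB; apply: ideal_gen_mulr => //; apply: mem_jacobian.
Qed.

End Arrangement.

Lemma prime_height_geS (R : comNzRingType) (P P' : {pred R}) h :
  prime_height_ge P h -> is_prime_ideal P' ->
  {subset P <= P'} -> ~ {subset P' <= P} -> prime_height_ge P' h.+1.
Proof.
case=> C [Cpr Cs Ch] P'pr PP' nP'P.
exists (fun k => if (k <= h)%N then C k else P'); split=> [k|k|f].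
- by case: ifP => // /Cpr.
- rewrite ltnS => kh; rewrite kh; move: kh; rewrite leq_eqVlt => /orP[/eqP ->|kh].
    rewrite ltnn; split=> [f|sub]; first by rewrite Ch => /PP'.
    by apply: nP'P => f /sub; rewrite Ch.
  by rewrite kh; apply: Cs.
- by rewrite ltnn.
Qed.

(** * The Jacobian ideal of a single pencil *)

Section ArrangementPlanes.
Variables (K : fieldType) (m s : nat) (l : 'I_s -> {mpoly K[m.+2]}).
Hypothesis charK : [pchar K] =i pred0.
Hypothesis l_linear : forall i, l i \is 1.-homog.
Hypothesis l_neq0 : forall i, l i != 0.
Hypothesis l_distinct : forall i j, hyperplane (l i) =i hyperplane (l j) -> i = j.
Local Notation S := {mpoly K[m.+2]}.
Variables i j : 'I_s.
Hypothesis ij : i != j.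
Local Notation I := (ideal_gen [:: l i; l j]).
Local Notation D := (pencil l i j).
Local Notation X := (jacobian_ideal (\prod_(t in D) l t)).

Lemma line_iso : plane_iso (@mpolyC m.+2 K) (@mpolyC m K) (l i) (l j).
Proof.
have := plane_iso_linear_forms (rows_indep l_linear l_neq0 l_distinct ij).
by rewrite -(form_rowE l_linear i) -(form_rowE l_linear j).
Qed.

Lemma line_prime : is_prime_ideal I.
Proof. by case: (plane_iso_line line_iso). Qed.

Lemma line_height_lt3 : ~ prime_height_ge I 3.
Proof. by case: (plane_iso_line line_iso). Qed.

Lemma prime_over_line (P : {pred S}) : is_prime_ideal P ->
  l i \in P -> l j \in P -> {subset I <= P}.
Proof.
case=> Pid _ iP jP f; apply: (ideal_gen_min (ideal_closed_proper Pid)) => g.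
by rewrite !inE => /orP[] /eqP ->.
Qed.

Lemma over_line_height_ge2 (P : {pred S}) : is_prime_ideal P ->
  {subset I <= P} -> prime_height_ge P 2.
Proof.
(* The chain is 0, then a prime [P1] containing l_i but not l_j, then [P]. *)
move=> Ppr IP; have [_ _ [P1 [P1pr P1I iP1 jP1]]] := plane_iso_line line_iso.
have P1h : prime_height_ge P1 1.
  apply: (@prime_height_geS _ [pred f : S | f == 0]) => //.
  - exists (fun=> [pred f : S | f == 0] : {pred S}); split=> // _ _.
    exact: (prime_ideal_ker (@idfun S)).
  - by move=> f; rewrite inE => /eqP ->; case: P1pr => [[]].
  - by move/(_ _ iP1); rewrite inE; apply/negP.
apply: prime_height_geS P1h Ppr _ _ => [f /P1I/IP //|PP1].
by case/negP: jP1; apply/PP1/IP/mem_ideal_gen; rewrite !inE eqxx orbT.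
Qed.

Lemma line_zero f (v : 'rV[K]_m.+2) : f \in I ->
  (l i).@[v 0] = 0 -> (l j).@[v 0] = 0 -> f.@[v 0] = 0.
Proof.
case/ideal_gen2P=> c [d ->] iv jv.
by rewrite mevalD !mevalM iv jv !mulr0 addr0.
Qed.

Lemma line_pencil_mem t : l t \in I -> t \in D.
Proof.
move=> tI; rewrite inE; apply/asboolP=> v /andP[/andP[_ /eqP iv] /andP[_ /eqP jv]].
exact: line_zero tI iv jv.
Qed.

(** The first three conditions together say that [X] is primary with radical (l_i, l_j). *)
Lemma pencil_structure :
  [/\ forall w c, w \notin I -> w * c \in X -> c \in X,
      {subset X <= I},
      exists k, l i ^+ k \in X /\ l j ^+ k \in X
    & exists gs, [/\ forall g, g \in gs -> exists d : nat, g \is d.-homog,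
        regular_sequence gs & X =i ideal_gen gs]].
Proof.
have [a [b [ai bi tE bn0 det]]] :=
  pencil_coords l_linear l_neq0 l_distinct ij.
have XE := pencil_jacobian l_linear l_neq0 l_distinct ij tE.
have iD : i \in D := pencil_l l_linear i j.
have jD : j \in D := pencil_r l_linear i j.
have lE : {in D, forall t, l t = (a t)%:MP * l i + (b t)%:MP * l j}.
  move=> t tD; rewrite {1}(form_rowE l_linear t) tE // linear_formD -!form_rowE //.
  by rewrite !mul_mpolyC.
have D2 : (1 < #|D|)%N.
  by rewrite (cardsD1 i) iD (cardsD1 j) in_setD1 eq_sym ij jD.
have Xcl : ideal_closed (fun f => f \in X) by apply: ideal_gen_closed.
have Dn0 : D != set0 by apply/set0Pn; exists i.
have unit_ab : {in D, forall t, exists c d, c * (a t)%:MP + d * (b t)%:MP = 1 :> S}.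
  move=> t tD; have [->|ti] := eqVneq t i.
    by exists 1, 0; rewrite ai mpolyC1 mul0r addr0 mulr1.
  exists 0, (b t)^-1%:MP; rewrite mul0r add0r -mpolyCM mulVf ?mpolyC1 //.
  by apply: bn0; rewrite in_setD1 ti.
have span (c d : K) : {in D &, forall t r, t != r ->
    exists e e', c%:MP * l i + d%:MP * l j = e * l t + e' * l r}.
  move=> t r tD rD tr; have dn0 := det t r tD rD tr.
  set dt := a t * b r - a r * b t in dn0.
  (* Cramer's rule, with determinant [dt]. *)
  exists ((c * b r - d * a r) / dt)%:MP, ((d * a t - c * b t) / dt)%:MP.
  rewrite (lE t) // (lE r) // !mulrDr !mulrA -!mpolyCM addrACA -!mulrDl -!mpolyCD.
  by congr (_%:MP * _ + _%:MP * _); rewrite /dt; field; rewrite -/dt.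
have pow (c d : K) : exists k, (c%:MP * l i + d%:MP * l j) ^+ k \in X.
  apply: (exp_in_jacobian (a := fun t => (a t)%:MP) (b := fun t => (b t)%:MP)
    Dn0 unit_ab (span c d) Xcl).
  - exact: (prod_mem_jacobian charK l_linear Dn0).
  - by rewrite XE; apply: mem_ideal_gen; rewrite !inE eqxx.
  - by rewrite XE; apply: mem_ideal_gen; rewrite !inE eqxx orbT.
have [k1 ik1] := pow 1 0; have [k2 jk2] := pow 0 1.
rewrite mpolyC0 mpolyC1 mul0r mul1r addr0 in ik1.
rewrite mpolyC0 mpolyC1 mul0r mul1r add0r in jk2.
rewrite XE in ik1; rewrite XE in jk2.
have [unmixed sub reg] := plane_iso_pencil line_iso iD ai bi lE bn0 D2 ik1 jk2.
split.
- by move=> w c wI; rewrite !XE; apply: unmixed.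
- by move=> f; rewrite XE; apply: sub.
- exists (k1 + k2)%N; rewrite !exprD !XE.
  by split; [apply: ideal_gen_mulr | apply: ideal_gen_mull].
- eexists; split; last exact: XE.
    have homD (E : {set 'I_s}) : \prod_(t in E) l t \is #|E|.-homog.
      rewrite -sum1_card; apply: (big_ind2 (fun (p : S) d => p \is d.-homog)) => //.
        exact: dhomog1.
      by move=> p1 d1 p2 d2 h1 h2; apply: dhomogM.
    have homA (c : 'I_s -> K) : \sum_(t in D) (c t)%:MP * \prod_(r in D :\ t) l r
        \is #|D|.-1.-homog.
      apply: rpred_sum => t tD; rewrite mul_mpolyC rpredZ //.
      by rewrite (cardsD1 t) tD homD.
    by move=> g; rewrite !inE => /orP[] /eqP ->; exists #|D|.-1; apply: homA.
  exact: reg.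
Qed.

Lemma pencil_zero_locus :
  zero_locus X =i [predI hyperplane (l i) & hyperplane (l j)].
Proof.
have [_ sub [k [ik jk]] _] := pencil_structure.
have zero_of t (v : 'rV[K]_m.+2) : l t ^+ k \in X ->
    (forall f, f \in X -> f.@[v 0] = 0) -> (l t).@[v 0] == 0.
  move=> tk /(_ _ tk); rewrite rmorphXn /= => /eqP.
  by rewrite expf_eq0 => /andP[].
move=> v; apply/andP/andP=> [[v0 /asboolP vX]|].
  by split; apply/andP; split=> //; apply: zero_of vX.
case=> /andP[v0 /eqP iv] /andP[_ /eqP jv]; split=> //.
by apply/asboolP => f /sub fI; apply: line_zero fI iv jv.
Qed.

(** Two linear equations in m + 2 > 2 unknowns have a nonzero solution; a variable with nonzero
    value there is outside [I]. *)
Lemma variable_notin_line : (0 < m)%N -> exists k, 'X_k \notin I.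
Proof.
move=> m0; pose M := col_mx (coef_row (l i)) (coef_row (l j)).
have kerM : cokermx M != 0.
  rewrite -mxrank_eq0 mxrank_coker subn_eq0 -ltnNge.
  by rewrite (leq_ltn_trans (rank_leq_row M)).
have [k [h kh]] : exists k h, cokermx M k h != 0.
  have /existsP[k /existsP[h kh]] : [exists k, exists h, cokermx M k h != 0].
    apply: contraNT kerM => /existsPn M0; apply/eqP/matrixP=> k h.
    by rewrite [RHS]mxE; apply/eqP; have /existsPn/(_ h) := M0 k; rewrite negbK.
  by exists k, h.
exists k; apply/negP=> kI; case/eqP: kh.
pose w := (col h (cokermx M))^T.
have wE t : (l t).@[w 0] = (coef_row (l t) *m cokermx M) 0 h.
  rewrite (meval_form l_linear) trmxK !mxE; apply: eq_bigr => r _.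
  by rewrite !mxE.
have := mulmx_coker M; rewrite {1}/M mul_col_mx -[0]vsubmxK => /eq_col_mx[Mi Mj].
have /(line_zero kI) : (l i).@[w 0] = 0 by rewrite wE Mi linear0 mxE.
have jw : (l j).@[w 0] = 0 by rewrite wE Mj linear0 mxE.
by move/(_ jw); rewrite mevalXU !mxE.
Qed.

Lemma pencil_complete_intersection : (0 < m)%N -> complete_intersection X.
Proof.
move=> /variable_notin_line[k kI]; have [unmixed _ _ gs] := pencil_structure.
split=> // f; apply/asboolP/idP => [[d fd]|fX]; last first.
  by exists 0%N => g _; apply: ideal_gen_mull.
(* Membership in the saturation makes f times this power an element of [X]; the power is outside the
   prime [I] and can be cancelled. *)
apply: (unmixed ('X_k ^+ d)); last first.
  by apply: fd; have := dhomogMn d (linear_form_homog (delta_mx 0 k : 'rV[K]_m.+2));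
    rewrite mul1n /linear_form (bigD1 k) //= big1 ?addr0 => [|r rk];
    rewrite mxE ?eqxx ?(negPf rk) ?scale0r ?scale1r.
have [_ _ Ipr] := is_prime_ideal_closed line_prime.
have [[_ I1 _] _] := line_prime.
elim: d {fd} => [|d IHd]; first by rewrite expr0.
by apply/negP; rewrite exprS => /Ipr[]; apply/negP.
Qed.

End ArrangementPlanes.

(** * The part of height two *)

Section HeightTwoPart.
Variables (K : fieldType) (m s : nat) (l : 'I_s -> {mpoly K[m.+2]}).
Hypothesis charK : [pchar K] =i pred0.
Hypothesis s_gt0 : (0 < s)%N.
Hypothesis l_linear : forall i, l i \is 1.-homog.
Hypothesis l_neq0 : forall i, l i != 0.
Hypothesis l_distinct : forall i j, hyperplane (l i) =i hyperplane (l j) -> i = j.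
Local Notation S := {mpoly K[m.+2]}.
Local Notation J := (jacobian_ideal (\prod_(t < s) l t)).
Local Notation line i j := (ideal_gen [:: l i; l j]).
Local Notation pencil_jac i j := (jacobian_ideal (\prod_(t in pencil l i j) l t)).

Lemma prime_over_jacobian (P : {pred S}) : is_prime_ideal P -> {subset J <= P} ->
  exists i j, i != j /\ {subset line i j <= P}.
Proof.
move=> Ppr JP; have [i [j [ij iP jP]]] := prime_jacobian charK l_linear l_neq0 s_gt0 Ppr JP.
by exists i, j; split=> //; apply: prime_over_line.
Qed.

(** A prime of height two over [Q] contains some (l_i, l_j) and equals it, since a larger prime has
    height at least 3. With u the product of the forms outside the pencil, f u^2 is in [Q], while no
    power of u is; so f is in [Q]. *)
Lemma pencil_jac_sub_primary (Q : {pred S}) f :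
  is_primary_ideal Q -> {subset J <= Q} -> ideal_height Q 2 ->
  (forall i j, i != j -> f \in pencil_jac i j) -> f \in Q.
Proof.
case=> Qid Qpr JQ [[P [Ppr QP [_ nP3]]] _] fX.
have [|i [j [ij IP]]] := prime_over_jacobian Ppr; first by move=> g /JQ/QP.
have PI : {subset P <= line i j}.
  apply: contrapT => nPI; apply: nP3.
  apply: prime_height_geS Ppr IP nPI.
  apply: (over_line_height_ge2 l_linear l_neq0 l_distinct ij) => //.
  exact: (line_prime l_linear l_neq0 l_distinct ij).
have := JQ _ (pencil_sub_jacobian charK l_linear (fX i j ij)).
case/Qpr=> [//|[k]]; rewrite -exprM => /QP/PI.
have [_ I1 Ipr] := is_prime_ideal_closed (line_prime l_linear l_neq0 l_distinct ij).
elim: (2 * k)%N => [|e IHe]; first by rewrite expr0 => /I1.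
rewrite exprS => /Ipr[|/IHe //]; apply: contraPP => _.
elim/big_rec: _ => [//|t g tD IH /Ipr[|//]].
by move/(line_pencil_mem); apply/negP; move: tD; rewrite in_setC.
Qed.

(** For f in [T] and fixed i, j, each component receives a multiple of f by an element outside (l_i,
    l_j). The product of these multipliers carries f into J, hence into the ideal of the pencil,
    where it cancels. *)
Lemma height_part_eq (T : {pred S}) : is_height_part 2 J T ->
  forall f, f \in T <-> (forall i j, i != j -> f \in pencil_jac i j).
Proof.
case=> r [Q [[Qprim JQ] TE]] f; rewrite TE.
have JQk k : {subset J <= Q k} by move=> g; rewrite JQ => /forallP/(_ k).
split=> [fQ i j ij|fX k hk]; last exact: pencil_jac_sub_primary (Qprim k) (JQk k) hk fX.
have Ipr := line_prime l_linear l_neq0 l_distinct ij.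
have [unmixed _ _ _] := pencil_structure charK l_linear l_neq0 l_distinct ij.
have [Icl I1 Ipc] := is_prime_ideal_closed Ipr.
have /choice[b bP] k : exists b, b \notin line i j /\ b * f \in Q k.
  have [hk|nhk] := pselect (ideal_height (Q k) 2).
    by exists 1; rewrite mul1r; split; [apply/negP | apply: fQ].
  (* A component inside (l_i, l_j) would have height two: that prime attains it, and any prime over
     the component contains J, so has height at least 2. *)
  have [QI|/not_subset_ex[b bQ bI]] := pselect {subset Q k <= line i j}.
    case: nhk; split.
      exists (line i j); split=> //; split.
        exact: (over_line_height_ge2 l_linear l_neq0 l_distinct ij).
      exact: (line_height_lt3 l_linear l_neq0 l_distinct ij).
    move=> P Ppr QP; have [|i' [j' [ij' IP]]] := prime_over_jacobian Ppr.
      by move=> g /JQk/QP.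
    exact: (over_line_height_ge2 l_linear l_neq0 l_distinct ij').
  exists b; split=> //; have [Qid _] := Qprim k.
  exact: ideal_closedMr (ideal_closed_proper Qid) bQ.
apply: (unmixed (\prod_k b k)).
  apply/negP; elim/big_rec: _ => [//|k g _ IH /Ipc[|//]].
  by apply/negP; case: (bP k).
apply: (jacobian_sub_pencil charK l_linear); rewrite JQ; apply/forallP=> k.
rewrite (bigD1 k) //= mulrAC; have [Qid _] := Qprim k.
by apply: (ideal_closedMr _ (ideal_closed_proper Qid)); case: (bP k).
Qed.

End HeightTwoPart.

(** * The top dimensional part as a union of pencil schemes *)

Theorem proposition4p1 (K : closedFieldType) (charK : [pchar K] =i pred0)
  (n s : nat) (hn : (2 <= n)%N) (hs : (2 <= s)%N)
  (l : 'I_s -> {mpoly K[n.+1]})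
  (l_linear : forall i, l i \is 1.-homog)
  (l_neq0 : forall i, l i != 0)
  (l_distinct : forall i j, hyperplane (l i) =i hyperplane (l j) -> i = j)
  (Jtop : {pred {mpoly K[n.+1]}})
  (hJtop : is_height_part 2 (jacobian_ideal (\prod_(i < s) l i)) Jtop) :
  exists (r : nat) (X : 'I_r -> {pred {mpoly K[n.+1]}}),
    same_scheme Jtop (bigcap_ideal X) /\
    forall k : 'I_r,
      complete_intersection (X k) /\
      exists i j : 'I_s,
        let Lambda := [predI hyperplane (l i) & hyperplane (l j)] in
        [/\ i != j,
            zero_locus (X k) =i Lambda
          & same_scheme (X k)
              (jacobian_ideal
                 (\prod_(t < s | l t \in vanishing_ideal Lambda) l t))].
Proof.
case: n hn l l_linear l_neq0 l_distinct Jtop hJtop => // m m_gt0.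
move=> l l_linear l_neq0 l_distinct Jtop /height_part_eq TE.
have {}TE := TE charK (ltnW hs) l_linear l_neq0 l_distinct.
(* Indexing by ordered pairs may repeat a Λ, which leaves the intersection unchanged. *)
pose pairs := [set ij : 'I_s * 'I_s | ij.1 != ij.2].
pose X (k : 'I_#|pairs|) := let ij := enum_val k in
  jacobian_ideal (\prod_(t in pencil l ij.1 ij.2) l t).
exists #|pairs|, X; split=> [|k].
  (* The ideals are equal even before saturation. *)
  suff -> : Jtop = bigcap_ideal X by [].
  apply/funext=> f; apply/idP/forallP=> [/TE fX k|fX].
    by apply: fX; have := enum_valP k; rewrite inE.
  apply/TE => i j ij; have ijP : (i, j) \in pairs by rewrite inE.
  by have := fX (enum_rank_in ijP (i, j)); rewrite /X enum_rankK_in.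
have := enum_valP k; rewrite inE /X; case: (enum_val k) => i j /= ij.
split; first exact: pencil_complete_intersection.
exists i, j; split=> //; first exact: pencil_zero_locus.
rewrite (_ : \prod_(t in _) _ = \prod_(t < s | l t \in vanishing_ideal
  [predI hyperplane (l i) & hyperplane (l j)]) l t) //.
by apply: eq_bigl => t; rewrite in_set.
Qed.
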